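(* Let $X$ be a (real) Banach space and let $\mathfrak I=\mathfrak A-\mathfrak B$, where $\mathfrak A:X\to(-\infty,+\infty]$ is proper, convex and lower semicontinuous and $\mathfrak B\in C^1(X,\mathbb R)$. Set $D(\mathfrak A)=\{u\in X:\mathfrak A(u)<+\infty\}$ and assume that $D(\mathfrak A)$ is convex. Let $S:(0,+\infty)\times X\to X$, $S_tu:=S(t,u)$, be a map such that: (S1) $S_1u=u$, and $S_tu\ne0$ whenever $u\neq0$; (S2) $S_{tr}u=S_t(S_ru)$ for all $t,r>0$ and $u\in X$; (S3) $\mathfrak A(S_tu)=\alpha(t)\mathfrak A(u)$ for every $t>0$ and $u\in D(\mathfrak A)\setminus\{0\}$, where $\alpha\in C^2(0,+\infty)$ satisfies $\alpha(1)=1$ and $\alpha'(t)>0$ for all $t>0$. Suppose that for every $u\in D(\mathfrak A)\setminus\{0\}$ the map $\gamma_u(t):=\mathfrak I(S_tu)$ is of class $C^1$ in $t>0$, and that $\mathfrak R:(0,+\infty)\times X\to\mathbb R$, $\mathfrak R(t,u):=\frac{d}{dt}\mathfrak B(S_tu)$, is (well defined and) of class $C^1$. Define $$\mathfrak P(u):=\gamma_u'(1)=\alpha'(1)\mathfrak A(u)-\mathfrak R(1,u),\qquad \mathfrak M:=\{u\in D(\mathfrak A)\setminus\{0\}:\mathfrak P(u)=0\}.$$ Let $u_0\in\mathfrak M$ satisfy $\mathfrak I(u_0)=\inf_{\mathfrak M}\mathfrak I$, and assume: (A1) for every $u\in D(\mathfrak A)\setminus\{0\}$ there exists a unique $t_u>0$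 such that $S_{t_u}u\in\mathfrak M$; moreover $t_u$ is the unique maximum point of $t\mapsto\mathfrak I(S_tu)$ on $(0,+\infty)$; (A2) the map $u\mapsto t_u$ is continuous on $D(\mathfrak A)\setminus\{0\}$; (A3) $\displaystyle\left.\frac{d}{dt}\left(\frac{\mathfrak R(t,u_0)}{\alpha'(t)}\right)\right|_{t=1}>0$. Then $u_0$ is a critical point of $\mathfrak I$ in the sense of Szulkin, namely $$\mathfrak A(u)-\mathfrak A(u_0)-\mathfrak B'(u_0)(u-u_0)\ge0\qquad\text{for all }u\in X.$$
   Context: $\mathfrak B'(u_0)\in X'$ denotes the Fréchet derivative of $\mathfrak B$ at $u_0$. Continuity on $D(\mathfrak A)\setminus\{0\}$ is with respect to the norm topology of $X$. *)

(* Defs.v *)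
From HB Require Import structures.
From mathcomp Require Import all_boot all_order all_algebra.
From mathcomp Require Import all_classical all_reals all_analysis.

Set Implicit Arguments.
Unset Strict Implicit.
Unset Printing Implicit Defensive.

Import Order.TTheory GRing.Theory Num.Theory.
Import numFieldNormedType.Exports.

Local Open Scope classical_set_scope.
Local Open Scope ring_scope.

Section ExtendedValued.
Context {R : realType} {X : normedModType R}.
Implicit Types A : X -> \bar R.
Local Open Scope ereal_scope.

Definition edom A : set X := [set u | A u < +oo].

Definition eproper A := edom A !=set0.

(* The library convention 0 * +oo = 0 makes the cases l = 0 and l = 1 harmless
   when A never takes the value -oo. *)
Definition econvex A := forall (u v : X) (l : R), (0 <= l <= 1)%R ->
  A (l *: u + (1 - l) *: v)%R <= l%:E * A u + (1 - l)%:E * A v.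

End ExtendedValued.

Section ContinuouslyDifferentiable.
Context {R : realType}.

(* Frechet C^1 on a set U, meant for open U: the last inequality says that the
   operator norm of 'd f y - 'd f x is at most e. *)
Definition C1_on (V W : normedModType R) (U : set V) (f : V -> W) :=
  (forall x, U x -> differentiable f x) /\
  (forall x, U x -> forall e : R, 0 < e ->
    \forall y \near x, forall h, `|'d f y h - 'd f x h| <= e * `|h|).

(* C^1 and C^2 on the open half-line (0, +oo). *)
Definition C1_pos (f : R -> R) :=
  forall t : R, 0 < t -> derivable f t 1 /\ {for t, continuous (derive1 f)}.

Definition C2_pos (f : R -> R) := C1_pos f /\ C1_pos (derive1 f).

End ContinuouslyDifferentiable.

Section Scaling.
Context {R : realType} {X : normedModType R}.
Variables (A : X -> \bar R) (B : X -> R) (S : R -> X -> X).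

Definition functional (u : X) : \bar R := (A u - (B u)%:E)%E.

(* The map S is only meaningful for t > 0. For such t and for u in
   edom A `\ 0, the scaling hypothesis on A makes functional (S t u) finite, so
   that fine loses nothing. *)
Definition fiber (u : X) (t : R) : R := fine (functional (S t u)).

Definition dB (t : R) (u : X) : R := derive1 (fun s => B (S s u)) t.

Definition pohozaev (u : X) : R := derive1 (fiber u) 1.

Definition pohozaev_set : set X :=
  [set u | (edom A `\ 0) u /\ pohozaev u = 0].

End Scaling.

(* Main.v *)
Require Import Defs.
From HB Require Import structures.
From mathcomp Require Import all_boot all_order all_algebra.
From mathcomp Require Import all_classical all_reals all_analysis.
From mathcomp Require Import lra.

Set Implicit Arguments.
Unset Strict Implicit.
Unset Printing Implicit Defensive.

Import Order.TTheory GRing.Theory Num.Theory.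
Import numFieldNormedType.Exports.

Local Open Scope classical_set_scope.
Local Open Scope ring_scope.

(** Suppose that [b - a - d < 0], where [a] and [b] are the values of [A] at [u0]
    and at some [v] of its domain, and [d] is the derivative of [B] at [u0]
    along [w = v - u0].  Move from [u0] towards [v] along the segment
    [x s = u0 + s w] and project each point back to the constraint set, at
    [S (t s) (x s)] with [t s = tmax (x s)]; since [tmax] is continuous,
    [t s] tends to [tmax u0 = 1].

    Writing [I = A - B], minimality of [u0] on the constraint set and maximality
    of [t = 1] on the fiber of [u0] give
    [I (S (t s) u0) <= I u0 <= I (S (t s) (x s))].
    Comparing the two ends, and bounding [A (x s)] by convexity,
    [0 <= alpha (t s) s (b - a) - (B (S (t s) (x s)) - B (S (t s) u0))].
    The remaining difference of values of [B] is [B (x s) - B u0] up to a mixed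
    second difference in [(t, x)].  Since the time derivative of [B (S t u)] is
    C^1, hence locally Lipschitz, that error is [O (s |t s - 1|) = o(s)]
    ([mixed_difference_le]).  Dividing by [s] and letting [s] tend to [0+] yields
    [0 <= b - a - d], a contradiction.

    What makes this work without any rate for [t s -> 1] is that [I] is never
    expanded in [t]: the fiber maximality at [u0] discards the whole dependence
    on [t] at [x = u0], and only the mixed term, which carries both factors [s]
    and [t s - 1], has to be small. *)

Lemma is_derive_line (R : realType) (V : normedModType R) (f : V -> R)
  (x w : V) (t : R) : differentiable f (x + t *: w) ->
  is_derive t 1 (fun s => f (x + s *: w)) ('d f (x + t *: w) w).
Proof.
move=> df; pose g (s : R) := x + s *: w.
have g_diff : is_diff t g (fun s : R => s *: w).
  by apply: is_diff_eq; apply/funext => s /=; rewrite add0r.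
have fg_diff : differentiable (f \o g) t by exact: differentiable_comp.
apply: DeriveDef; first exact/derivable1_diffP.
rewrite deriveE// (@diff_comp _ _ _ _ g f)//.
by rewrite /= diff_val scale1r.
Qed.

Lemma derive1_bounded_lipschitz (R : realType) (f : R -> R) (i : interval R) (k : R) :
  {in i, forall t, derivable f t 1} -> {in i, forall t, `|derive1 f t| <= k} ->
  k.-lipschitz_[set` i] f.
Proof.
move=> f_derivable f'_le [y x] /= [yi xi].
wlog xy : x y yi xi / x <= y.
  move=> wlog_le; have [/wlog_le|/ltW /wlog_le] := leP x y; first exact.
  by rewrite distrC [`|x - y|]distrC; exact.
have sub_i (t : R) : t \in `[x, y] -> t \in i.
  by rewrite in_itv/=; apply: (interval_is_interval xi yi).
have f_derive (t : R) : t \in `]x, y[ -> is_derive t 1 f (derive1 f t).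
  move=> /subset_itv_oo_cc /sub_i /f_derivable ?.
  by rewrite derive1E; exact: derivableP.
have [|c /sub_i ci ->] := MVT_segment xy f_derive.
  by apply: derivable_within_continuous => t /sub_i /f_derivable.
by rewrite normrM ler_wpM2r// f'_le.
Qed.

(** The differential is bounded near [x0], by its norm at [x0] plus one; balls
    being convex, the mean value theorem along a segment turns this bound into
    a Lipschitz constant. *)
Lemma C1_locally_lipschitz (R : realType) (V : normedModType R) (U : set V)
    (f : V -> R) (x0 : V) : nbhs x0 U -> C1_on U f ->
  exists k e : R, 0 < e /\ k.-lipschitz_(ball x0 e) f.
Proof.
move=> U_x0 [f_diff f_C1].
have U1 := f_C1 _ (nbhs_singleton U_x0) 1 ltr01.
have [k k_bound] : exists k : R, forall h, `|'d f x0 h| <= k * `|h|.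
  have /linear_boundedP : bounded_near ('d f x0) (nbhs 0).
    apply: continuous_linear_bounded.
    by apply: diff_continuous; exact: f_diff (nbhs_singleton U_x0).
  by move=> /pinfty_ex_gt0[k _ kP]; exists k; exact: kP.
have : \forall y \near x0, U y /\ forall h, `|'d f y h - 'd f x0 h| <= 1 * `|h|.
  exact: filterI U_x0 U1.
move=> /nbhs_ballP[e /= e_gt0 eP].
exists (k + 1), e; split=> // -[y x] /= [y_ball x_ball].
set w := y - x.
have line_ball (s : R) : s \in `[0, 1] -> ball x0 e (x + s *: w).
  rewrite in_itv/= => /andP[s0 s1].
  move: y_ball x_ball; rewrite -!ball_normE /= => y_ball x_ball.
  have -> : x0 - (x + s *: w) = s *: (x0 - y) + (1 - s) *: (x0 - x).
    rewrite scalerBl scale1r addrCA -scalerBr opprD -scalerN addrA.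
    by rewrite !opprB [x - x0]addrC addrACA subrr add0r [- y + x]addrC.
  rewrite (le_lt_trans (ler_normD _ _))// !normrZ ger0_norm// ger0_norm ?subr_ge0//.
  (* Strictness comes from the bound on [y], whose weight [s] must not vanish. *)
  have [->|s_neq0] := eqVneq s 0; first by rewrite mul0r subr0 add0r mul1r.
  have s_gt0 : 0 < s by rewrite lt0r s_neq0.
  have := ler_wpM2l (_ : 0 <= 1 - s) (ltW x_ball); rewrite subr_ge0 => /(_ s1).
  have : s * `|x0 - y| < s * e by rewrite ltr_pM2l.
  by lra.
pose g (s : R) : R := f (x + s *: w).
have g_derive (s : R) : s \in `[0, 1] -> is_derive s 1 g ('d f (x + s *: w) w).
  by move=> /line_ball/eP[/f_diff sdiff _]; exact: is_derive_line.
have g_lip : ((k + 1) * `|w|).-lipschitz_[set` `[0, 1]] g.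
  apply: derive1_bounded_lipschitz => s s01; have ? := g_derive s s01.
    exact: ex_derive.
  rewrite derive1E derive_val.
  have [_ /(_ w)] := eP _ (line_ball _ s01); rewrite mul1r => le1.
  rewrite mulrDl mul1r [leRHS]addrC -[leLHS](subrK (`|'d f x0 w|)).
  by rewrite lerD// (le_trans (lerB_dist _ _)).
have /= := g_lip (1, 0); rewrite !in_itv/= !lexx ler01 subr0 normr1 mulr1.
by rewrite /g scale1r scale0r addr0 /w subrKC; exact.
Qed.

(** The difference [F t x - F t x0] is itself a function of [t] whose derivative
    is a difference of two values of the C^1 function [dF/dt], hence at most
    [k |x - x0|]; the mean value theorem between [t0] and [t] brings the second
    small factor. *)
Lemma mixed_difference_le (R : realType) (X : normedModType R)
    (F : R -> X -> R) (t0 : R) (x0 : X) : 0 < t0 ->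
  (forall t x, 0 < t -> derivable (F^~ x) t 1) ->
  C1_on [set p : R * X | 0 < p.1] (fun p => derive1 (F^~ p.2) p.1) ->
  exists k e : R, 0 < e /\ forall t x, ball t0 e t -> ball x0 e x ->
    `|(F t x - F t x0) - (F t0 x - F t0 x0)| <= k * `|x - x0| * `|t - t0|.
Proof.
move=> t0_gt0 F_derivable F_C1.
have pos_nbhs : nbhs (t0, x0) [set p : R * X | 0 < p.1].
  have : \forall t \near t0, 0 < t by exact: lt_nbhsr.
  exact: cvg_fst.
have [k [e [e_gt0 k_lip]]] := C1_locally_lipschitz pos_nbhs F_C1.
(* The radius is capped by [t0] so that only positive times are met. *)
exists k, (Num.min e t0); split; first by rewrite lt_min e_gt0.
move=> t x t_ball x_ball.
pose e' := Num.min e t0.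
have e'e : ball x0 e' `<=` ball x0 e by apply: le_ball; rewrite ge_min lexx.
pose i : interval R := `]t0 - e', t0 + e'[.
have iP (s : R) : s \in i -> 0 < s /\ ball t0 e s.
  rewrite in_itv/= => /andP[s_gt s_lt].
  have le_e : e' <= e by rewrite /e' ge_min lexx.
  have le_t0 : e' <= t0 by rewrite /e' ge_min lexx orbT.
  split; first by lra.
  by rewrite -ball_normE/= ltr_distl; apply/andP; split; lra.
have d_derivable (s : R) : s \in i -> derivable (F^~ x - F^~ x0) s 1.
  by move=> /iP[s_gt0 _]; apply: derivableB; exact: F_derivable.
have d_lip : (k * `|x - x0|).-lipschitz_[set` i] (F^~ x - F^~ x0).
  apply: derive1_bounded_lipschitz => // s /iP[s_gt0 s_ball].
  rewrite derive1E deriveB; [|exact: F_derivable..]; rewrite -!derive1E.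
  have /= := k_lip ((s, x), (s, x0)).
  rewrite /self_sub/= prod_normE/= subrr normr0 max_r//; apply.
  by split; split => //=; [exact: e'e|exact: ballxx].
have /= := d_lip (t, t0); apply; split; rewrite /= in_itv/=.
  by rewrite -ltr_distl distrC; move: t_ball; rewrite -ball_normE.
have e'_gt0 : 0 < e' by rewrite lt_min e_gt0.
by apply/andP; split; lra.
Qed.

Theorem lemmaA1 (R : realType) (X : completeNormedModType R)
  (A : X -> \bar R) (B : X -> R)
  (A_gtNy : forall u, (-oo < A u)%E)
  (A_proper : eproper A)
  (A_convex : econvex A)
  (A_lsc : lower_semicontinuous A)
  (B_C1 : C1_on setT B)
  (domA_convex : convex_set (edom A : set (convex_lmodType X)))
  (S : R -> X -> X) (alpha : R -> R)
  (S1 : forall u, S 1 u = u)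
  (S_neq0 : forall (t : R) u, 0 < t -> u != 0 -> S t u != 0)
  (S2 : forall (t r : R) u, 0 < t -> 0 < r -> S (t * r) u = S t (S r u))
  (S3 : forall (t : R) u, 0 < t -> (edom A `\ 0) u ->
          A (S t u) = ((alpha t)%:E * A u)%E)
  (alpha_C2 : C2_pos alpha)
  (alpha1 : alpha 1 = 1)
  (alpha_incr : forall t : R, 0 < t -> 0 < derive1 alpha t)
  (fiber_C1 : forall u, (edom A `\ 0) u -> C1_pos (fiber A B S u))
  (dB_exists : forall (t : R) u, 0 < t -> derivable (fun s => B (S s u)) t 1)
  (dB_C1 : C1_on [set p : R * X | 0 < p.1]
             (fun p : R * X => dB B S p.1 p.2))
  (u0 : X)
  (u0_in : pohozaev_set A B S u0)
  (u0_min : functional A B u0 =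
              ereal_inf [set functional A B u | u in pohozaev_set A B S])
  (tmax : X -> R)
  (A1_unique : forall u, (edom A `\ 0) u ->
     unique (fun t : R => 0 < t /\ pohozaev_set A B S (S t u)) (tmax u))
  (A1_max : forall u, (edom A `\ 0) u ->
     unique (fun t : R => 0 < t /\ forall s : R, 0 < s ->
               (functional A B (S s u) <= functional A B (S t u))%E) (tmax u))
  (A2 : {within edom A `\ 0, continuous tmax})
  (A3 : 0 < derive1 (fun t : R => dB B S t u0 / derive1 alpha t) 1) :
  forall u : X, (0 <= A u - A u0 - ('d B u0 (u - u0))%:E)%E.

Proof.
move=> v; have [[u0_dom /eqP u0_neq0] _] := u0_in.
have finA u : edom A u -> A u = (fine (A u))%:E.
  by move=> u_dom; rewrite fineK// fin_real// A_gtNy.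
(* Outside the domain of [A] the left-hand side is +oo. *)
have [v_dom|] := boolP (A v < +oo)%E; last first.
  by rewrite ltey negbK => /eqP ->; rewrite (finA _ u0_dom) leey.
pose w := v - u0.
set a := fine (A u0); set b := fine (A v); set d := 'd B u0 w.
rewrite (finA _ u0_dom) (finA _ v_dom) -/a -/b -/w -/d lee_fin leNgt.
apply/negP => gap_lt0.
pose x (s : R) : X := u0 + s *: w.
pose D := edom A `\ 0.
have D_u0 : D u0 by split=> //; exact/eqP.
have x_segment (s : R) : 0 <= s <= 1 ->
    edom A (x s) /\ fine (A (x s)) <= a + s * (b - a).
  move=> s01; have := A_convex v u0 s s01.
  rewrite (finA _ u0_dom) (finA _ v_dom) -/a -/b -!EFinM -EFinD.
  have -> : s *: v + (1 - s) *: u0 = x s.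
    by rewrite /x /w scalerBr scalerBl scale1r addrCA addrA.
  move=> le_A; have x_dom : edom A (x s) by exact: le_lt_trans le_A (ltry _).
  by split=> //; move: le_A; rewrite (finA _ x_dom) lee_fin /=; lra.
have x_cvg : x s @[s --> 0^'+] --> u0.
  have : x s @[s --> (0 : R)] --> x 0.
    apply: cvgD; first exact: cvg_cst.
    by apply: cvgZr_tmp; exact: cvg_id.
  by rewrite {2}/x scale0r addr0; exact: cvg_at_right_filter.
have x_D : \forall s \near 0^'+, D (x s).
  near=> s; split.
    apply: (x_segment s _).1; apply/andP; split=> //.
    by near: s; exact: nbhs_right_le.
  by apply/eqP; near: s; exact: cvgr_neq0 x_cvg u0_neq0.
have tmax_u0 : tmax u0 = 1.
  by have [_] := A1_unique _ D_u0; apply; split=> //; rewrite S1.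
pose t (s : R) : R := tmax (x s).
have t_cvg : t s @[s --> 0^'+] --> (1 : R).
  have : tmax u @[u --> within D (nbhs u0)] --> (1 : R).
    by rewrite -tmax_u0; move/subspace_continuousP : A2; exact.
  apply: cvg_trans; rewrite /t => P /= nbhsP.
  have : \forall s \near 0^'+, D (x s) -> P (tmax (x s)) by exact: x_cvg nbhsP.
  by apply: filterS2 x_D => s Dxs; exact.
have [k [e [e_gt0 B_mixed]]] := mixed_difference_le u0 ltr01 dB_exists dB_C1.
have dquot_cvg : s^-1 * (B (x s) - B u0) @[s --> 0^'+] --> d.
  apply: cvg_dnbhs_at_right.
  have B_diff : differentiable B u0 by exact: B_C1.1.
  have := @diff_derivable _ _ _ B u0 w B_diff; rewrite /derivable.
  rewrite -[lim _]/('D_w B u0) deriveE// -/d.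
  by under eq_fun do rewrite /= [_ *: w + u0]addrC.
have alpha_t_cvg : alpha (t s) @[s --> 0^'+] --> (1 : R).
  rewrite -[X in _ --> X]alpha1; apply: continuous_cvg t_cvg.
  have [alpha_derivable _] := alpha_C2.1 1 ltr01.
  exact/differentiable_continuous/derivable1_diffP.
(* [s * slope s] bounds [I (S (t s) (x s)) - I (S (t s) u0)] from above. *)
pose slope (s : R) := alpha (t s) * (b - a) + k * `|w| * `|t s - 1|
  - s^-1 * (B (x s) - B u0).
have slope_cvg : slope s @[s --> 0^'+] --> b - a - d.
  rewrite (_ : b - a - d = 1 * (b - a) + k * `|w| * `|1 - 1| - d); last first.
    by rewrite subrr normr0 mulr0 addr0 mul1r.
  apply: cvgB dquot_cvg; apply: cvgD; first exact: cvgMr_tmp.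
  by apply: cvgMl_tmp; apply: cvg_norm; apply: cvgB t_cvg _; exact: cvg_cst.
have slope_ge0 : \forall s \near (0 : R)^'+, 0 <= slope s.
  near=> s.
  have s_gt0 : 0 < s by [].
  have xD : D (x s) by near: s.
  have [[t_gt0 tM] _] := A1_unique _ xD; rewrite -/(t s) in t_gt0 tM.
  have alpha_gt0 : 0 < alpha (t s) by near: s; exact: cvgr_gt alpha_t_cvg _ ltr01.
  have [_ Ax_le] : edom A (x s) /\ fine (A (x s)) <= a + s * (b - a).
    apply: x_segment; apply/andP; split; first exact: ltW.
    by near: s; exact: nbhs_right_le.
  have minM : a - B u0 <= alpha (t s) * fine (A (x s)) - B (S (t s) (x s)).
    have : (functional A B u0 <= functional A B (S (t s) (x s)))%E.
      by rewrite u0_min; apply: ereal_inf_lbound; exists (S (t s) (x s)).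
    by rewrite /functional S3// (finA _ u0_dom) (finA _ xD.1).
  have maxfiber : alpha (t s) * a - B (S (t s) u0) <= a - B u0.
    have [[_ /(_ _ t_gt0)]] := A1_max _ D_u0.
    by rewrite tmax_u0 S1 /functional S3// (finA _ u0_dom).
  have mixed : `|B (S (t s) (x s)) - B (S (t s) u0) - (B (x s) - B u0)|
      <= k * (s * `|w|) * `|t s - 1|.
    have -> : s * `|w| = `|x s - u0|.
      by rewrite /x addrAC subrr add0r normrZ gtr0_norm.
    have := B_mixed (t s) (x s); rewrite !S1; apply.
      by near: s; exact: cvg_ball t_cvg _ e_gt0.
    by near: s; exact: cvg_ball x_cvg _ e_gt0.
  (* The linear combination below is [minM + maxfiber + mixed + scaled]. *)
  have := ler_wpM2l (ltW alpha_gt0) Ax_le.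
  move: mixed; rewrite ler_norml => /andP[mixed _] scaled.
  rewrite -(pmulr_rge0 _ s_gt0) /slope mulrBr (mulrA s s^-1) mulfV ?gt_eqF// mul1r.
  by nra.
by move: gap_lt0; rewrite ltNge (cvgr_to_ge slope_cvg slope_ge0).
Unshelve. all: by end_near.
Qed.
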